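(* Let $0=x_{n,0}<x_{n,1}<\dots<x_{n,l_n}=1$ and let $c_{n,i}:[0,1]\to[0,\infty)$, $i=0,\dots,l_n$, satisfy $\sum_{i=0}^{l_n}c_{n,i}(x)=1$ for all $x\in[0,1]$. For $f:[0,1]\to\mathbb R$ and $F:[0,1]\to\mathfrak J$ define $$\widetilde O_n(f,x)=\sum_{i=0}^{l_n}c_{n,i}(x)f(x_{n,i}),\qquad O_n(F,x)=\bigotimes_{i=0}^{l_n}c_{n,i}(x)F(x_{n,i}).$$ Then $O_n$ is monotonicity preserving if and only if $\widetilde O_n$ is monotonicity preserving.
   Context: Fix $m\ge1$ and let $\mu$ be Lebesgue measure on $\mathbb R^m$. $\mathbb J$ denotes the collection of Jordan measurable subsets of $\mathbb R^m$ (bounded sets whose boundary has Lebesgue measure zero). $\operatorname{ci}(A)$ is the closure of the interior of $A$; a bounded set $A$ is regular compact if $A=\operatorname{ci}(A)$. $\mathfrak J\subset\mathbb J$ is the collection of regular compact sets in $\mathbb J$ (including $\emptyset$). A subset-generating function is a map $\Psi:\mathbb J\times[0,1]\to\mathfrak J$ such that for all $A\in\mathbb J$ and $s,t\in[0,1]$: (1) $\Psi(A,t)\subseteq A$ up to a null set, i.e. $\mu(\Psi(A,t)\setminus A)=0$; (2) $\mu(\Psi(A,t))=t\,\mu(A)$; (3) $\Psi(A,s)\subseteq\Psi(A,t)$ if $s\le t$. A subset-generating function $\Psi$ is fixed. For $A_0,\dots,A_n\in\mathfrak J$ and nonempty $\chi\subseteq\{0,\dots,n\}$ put $\Omega_\chi=\big(\bigcap_{k\in\chi}A_k\big)\setminus\big(\bigcup_{l\in\{0,\dots,n\}\setminus\chi}A_l\big)$,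 and $\Omega_\emptyset=\emptyset$. For weights $\alpha_i\in[0,1]$ with $\sum_i\alpha_i=1$, the partition average is $\bigotimes_{i=0}^n\alpha_iA_i:=\bigcup_{\chi\subseteq\{0,\dots,n\}}\Psi\big(\Omega_\chi,\sum_{k\in\chi}\alpha_k\big)\in\mathfrak J$. A set-valued function $F:[0,1]\to\mathfrak J$ is monotone non-decreasing (non-increasing) if $x\le y$ implies $F(x)\subseteq F(y)$ ($F(x)\supseteq F(y)$). An operator ($O_n$ on set-valued functions, $\widetilde O_n$ on real-valued functions) is monotonicity preserving if it maps every monotone non-decreasing function to a monotone non-decreasing function of $x\in[0,1]$, and every monotone non-increasing function to a monotone non-increasing one. *)

(* Defs.v *)
From HB Require Import structures.
From mathcomp Require Import all_boot all_order all_algebra.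
From mathcomp Require Import all_classical all_reals all_analysis.

Set Implicit Arguments.
Unset Strict Implicit.
Unset Printing Implicit Defensive.

Import Order.TTheory GRing.Theory Num.Theory.
Import numFieldNormedType.Exports.

Local Open Scope classical_set_scope.
Local Open Scope ring_scope.

(* The ambient space is 'rV[R]_m.+1, i.e. R^(m+1) with m : nat arbitrary, so
   that the dimension ranges over all integers >= 1. *)

Section lebesgue.
Context {R : realType} {m : nat}.
Notation V := 'rV[R]_m.+1.

(* A pair p of opposite corners encodes the closed box
   prod_i [p.1 i, p.2 i]; the box is empty when p.2 i < p.1 i for some i, and
   Num.max makes its volume 0 in that case. *)
Definition box (p : V * V) : set V :=
  [set v | forall i, p.1 ord0 i <= v ord0 i <= p.2 ord0 i].

Definition box_vol (p : V * V) : R :=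
  \prod_(i < m.+1) Num.max 0 (p.2 ord0 i - p.1 ord0 i).

Definition box_cover (A : set V) : set (nat -> V * V) :=
  [set B | A `<=` \bigcup_k box (B k)].

Definition lebesgue_outer (A : set V) : \bar R :=
  ereal_inf [set (\sum_(k <oo) (box_vol (B k))%:E)%E | B in box_cover A].

Lemma box_vol_ge0 p : 0 <= box_vol p.
Proof. by apply: prodr_ge0 => i _; rewrite le_max lexx. Qed.

Lemma box_vol_diag v : box_vol (v, v) = 0.
Proof.
by rewrite /box_vol big_ord_recl /= subrr maxxx mul0r.
Qed.

Local Open Scope ereal_scope.

Lemma lebesgue_outer_ge0 A : 0 <= lebesgue_outer A.
Proof.
apply: le_ereal_inf_tmp => _ [B AB <-].
by apply: nneseries_ge0 => k _ _; rewrite lee_fin box_vol_ge0.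
Qed.

Lemma lebesgue_outer0 : lebesgue_outer set0 = 0.
Proof.
apply/eqP; rewrite eq_le lebesgue_outer_ge0 andbT.
apply: ereal_inf_lbound; exists (fun=> (0%R, 0%R)) => //.
by rewrite eseries0// => k _ _; rewrite box_vol_diag.
Qed.

Lemma le_lebesgue_outer : {homo lebesgue_outer : A B / A `<=` B >-> A <= B}.
Proof.
move=> A B AB; apply/ereal_inf_le_tmp => _ [C BC <-].
by exists C => //; exact: subset_trans AB BC.
Qed.

Lemma lebesgue_outer_sigma_subadditive : sigma_subadditive lebesgue_outer.
Proof.
move=> A; have [[i ioo]|] := pselect (exists i, lebesgue_outer (A i) = +oo).
  rewrite (eseries_pinfty _ _ ioo) ?leey// => n _.
  by rewrite -ltNye (lt_le_trans _ (lebesgue_outer_ge0 _)).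
rewrite -forallNE => Aoo.
suff add2e (e : {posnum R}) : lebesgue_outer (\bigcup_n A n) <=
    \sum_(i <oo) lebesgue_outer (A i) + e%:num%:E.
  by apply/lee_addgt0Pr => _/posnumP[].
rewrite (le_trans _ (epsilon_trick _ _ _))//; last first.
  by move=> n; exact: lebesgue_outer_ge0.
pose P n (B : nat -> V * V) := box_cover (A n) B /\
  \sum_(k <oo) (box_vol (B k))%:E <=
    lebesgue_outer (A n) + (e%:num / (2 ^ n.+1)%:R)%:E.
have [G PG] : {G : nat -> nat -> V * V & forall n, P n (G n)}.
  apply: (@choice _ _ P) => n; rewrite /P /lebesgue_outer.
  set S := (X in ereal_inf X); move infS : (ereal_inf S) => iS.
  case: iS infS => [r Sr|Soo|Soo].
  - have en1 : (0 < e%:num / (2 ^ n.+1)%:R)%R by [].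
    have /(lb_ereal_inf_adherent en1) : ereal_inf S \is a fin_num by rewrite Sr.
    move=> [x [B AnB vB] xS].
    by exists B; split => //; rewrite vB -Sr; exact/ltW.
  - by have := Aoo n; rewrite /lebesgue_outer Soo.
  - by have := lebesgue_outer_ge0 (A n); rewrite /lebesgue_outer -/S Soo.
pose vol ij := (box_vol (uncurry G ij))%:E.
have vol_ge0 ij : 0 <= vol ij by rewrite lee_fin box_vol_ge0.
apply: (@le_trans _ _ (\esum_(i in setT) vol i)).
  apply: ereal_inf_lbound => /=.
  have /card_esym/ppcard_eqP[f] := card_nat2.
  exists (uncurry G \o f).
    move=> t [i _ /(PG i).1[j _ Gijt]].
    by exists (f^-1%FUN (i, j)) => //=; rewrite invK ?inE.
  rewrite -(esum_pred_image vol f xpredT)// ?[fun=> _]set_true//.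
  by rewrite image_eq.
rewrite (_ : esum _ _ = \sum_(i <oo) \sum_(j <oo) vol (i, j)); last first.
  pose J : nat -> set (nat * nat) := fun i => [set (i, j) | j in setT].
  rewrite (_ : setT = \bigcup_k J k); last first.
    by rewrite predeqE => -[a b]; split => // _; exists a => //; exists b.
  rewrite esum_bigcupT//=; last first.
    apply/trivIsetP => i j _ _ ij.
    rewrite predeqE => -[n k] /=; split => //= -[] [_] _ [<-{n} _].
    by move=> [k' _] [] /esym/eqP; rewrite (negbTE ij).
  rewrite -(image_id [set: nat]) -fun_true esum_pred_image//; last first.
    by move=> n _; exact: esum_ge0.
  apply: eq_eseriesr => /= j _.
  rewrite -(esum_pred_image vol (pair j) predT)//=; last first.
    by move=> ? ? _ _; exact: (@can_inj _ _ _ snd).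
  by congr esum; rewrite predeqE => -[a b]; split; move=> [i _ <-]; exists i.
apply: lee_nneseries => [i _ _|i _]; first by apply: nneseries_ge0 => j _ _.
exact: (PG i).2.
Qed.

HB.instance Definition _ := isOuterMeasure.Build R V lebesgue_outer
  lebesgue_outer0 lebesgue_outer_ge0 le_lebesgue_outer
  lebesgue_outer_sigma_subadditive.

Definition lebesgue_outer_measure : {outer_measure set V -> \bar R} :=
  lebesgue_outer.

(* Lebesgue measure on R^(m+1), by Caratheodory's theorem; as a function on sets
   it is lebesgue_outer, and it is a measure on the (complete) sigma-algebra of
   Lebesgue measurable sets, which contains every set in [jordan] below. *)
Definition lebesgue_rV :
    {measure set (caratheodory_type lebesgue_outer_measure) -> \bar R} :=
  lebesgue_outer_measure.

End lebesgue.

Section jordan_sets.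
Context {R : realType} {m : nat}.
Notation V := 'rV[R]_m.+1.
Implicit Types A : set V.

Definition jordan : set (set V) :=
  [set A | bounded_set A /\ lebesgue_rV (closure A `\` A°) = 0%E].

Definition regular_compact : set (set V) :=
  [set A | bounded_set A /\ regclosed A].

Definition regular_jordan : set (set V) := jordan `&` regular_compact.

(* Psi is a total function; only its values on jordan sets and on t in [0, 1]
   are constrained, and only these are used in [partition_average]. *)
Record subset_generating (Psi : set V -> R -> set V) : Prop := {
  subset_generating_regular : forall A t, jordan A -> t \in `[0, 1] ->
    regular_jordan (Psi A t) ;
  subset_generating_sub : forall A t, jordan A -> t \in `[0, 1] ->
    lebesgue_rV (Psi A t `\` A) = 0%E ;
  subset_generating_measure : forall A t, jordan A -> t \in `[0, 1] ->
    lebesgue_rV (Psi A t) = (t%:E * lebesgue_rV A)%E ;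
  subset_generating_homo : forall A s t, jordan A ->
    s \in `[0, 1] -> t \in `[0, 1] -> s <= t -> Psi A s `<=` Psi A t }.

Definition Omega (n : nat) (A : 'I_n.+1 -> set V) (chi : {set 'I_n.+1}) :
    set V :=
  if chi == finset.set0 then set0 else
  (\bigcap_(k in [set` chi]) A k) `\` (\bigcup_(l in ~` [set` chi]) A l).

Definition partition_average (Psi : set V -> R -> set V) (n : nat)
    (alpha : 'I_n.+1 -> R) (A : 'I_n.+1 -> set V) : set V :=
  \bigcup_(chi in [set: {set 'I_n.+1}])
    Psi (Omega A chi) (\sum_(k in chi) alpha k).

(* Functions on [0, 1] are represented by functions on R of which only the
   restriction to [0, 1] matters. *)
Definition set_monotonicity_preserving (O : (R -> set V) -> (R -> set V)) :=
  forall F : R -> set V, {in `[0, 1], forall x, regular_jordan (F x)} ->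
    ({in `[0, 1] &, {homo F : x y / x <= y >-> x `<=` y}} ->
     {in `[0, 1] &, {homo O F : x y / x <= y >-> x `<=` y}}) /\
    ({in `[0, 1] &, {homo F : x y / x <= y >-> y `<=` x}} ->
     {in `[0, 1] &, {homo O F : x y / x <= y >-> y `<=` x}}).

Definition set_operator (Psi : set V -> R -> set V) (l : nat)
    (x : 'I_l.+1 -> R) (c : 'I_l.+1 -> R -> R) (F : R -> set V) : R -> set V :=
  fun y => partition_average Psi (fun i => c i y) (fun i => F (x i)).

End jordan_sets.

Section real_operators.
Context {R : realType}.

Definition monotonicity_preserving (O : (R -> R) -> (R -> R)) :=
  forall f : R -> R,
    ({in `[0, 1] &, {homo f : x y / x <= y}} ->
     {in `[0, 1] &, {homo O f : x y / x <= y}}) /\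
    ({in `[0, 1] &, {homo f : x y / x <= y >-> y <= x}} ->
     {in `[0, 1] &, {homo O f : x y / x <= y >-> y <= x}}).

Definition real_operator (l : nat) (x : 'I_l.+1 -> R) (c : 'I_l.+1 -> R -> R)
    (f : R -> R) : R -> R :=
  fun y => \sum_(i < l.+1) c i y * f (x i).

End real_operators.

(* Main.v *)
(* Both monotonicity properties are equivalent to a condition on the weights
   alone: for every set [chi] of nodes closed upwards, the sum of [c k y] over
   [k] in [chi] is nondecreasing in [y]. On the real side, this is tested on
   step functions and recovered by Abel summation. On the set side, for
   nondecreasing [F] the cell [Omega chi] is empty unless [chi] is closed
   upwards (downwards for nonincreasing [F], where the sums are the
   complements to 1), so that the monotonicity of [Psi] in its second argument
   applies; conversely, testing on an [F] equal to a set of measure 1 on [chi]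
   and empty below, the measure of the partition average is exactly the sum
   over [chi]. That empty cells contribute nothing, [Psi set0 t = set0], needs
   nonempty open sets to have positive Lebesgue measure. *)
Require Import Defs.
From mathcomp Require Import all_boot all_order all_algebra.
From mathcomp Require Import all_classical all_reals all_analysis.
From mathcomp Require Import measurable_realfun.
Set Implicit Arguments.
Unset Strict Implicit.

Import Order.TTheory GRing.Theory Num.Theory.
Import numFieldNormedType.Exports.
Local Open Scope classical_set_scope.
Local Open Scope ring_scope.

(** * Volumes of boxes and positivity of Lebesgue measure on open sets *)

Lemma lebesgue_measure_segment (R : realType) (a b : R) :
  lebesgue_measure [set` `[a, b]] = (Num.max 0 (b - a))%:E.
Proof.
rewrite lebesgue_measure_itv/= lte_fin.
case: ltP => ab; first by rewrite -EFinB max_r// subr_ge0 ltW.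
by rewrite max_l// subr_le0.
Qed.

(* Coordinates are removed one at a time by integrating the covering
   inequality over the last of them; the weights [w] absorb the indicators of
   the coordinates already fixed. *)
Lemma le_prod_nneseries_indic (R : realType) (n : nat) (a b : nat -> R)
    (p q : nat -> nat -> R) (w : nat -> R) (C : R) :
  0 <= C -> (forall k, 0 <= w k) ->
  (forall v : nat -> R, (forall i, (i < n)%N -> a i <= v i <= b i) ->
    (C%:E <= \sum_(k <oo)
      (w k * \prod_(i < n) \1_[set` `[p k i, q k i]] (v i))%:E)%E) ->
  ((C * \prod_(i < n) Num.max 0 (b i - a i))%:E <=
    \sum_(k <oo) (w k * \prod_(i < n) Num.max 0 (q k i - p k i))%:E)%E.
Proof.
elim: n => [|n IH] in w C * => C0 w0 cover.
  have /cover/le_trans : forall i, (i < 0)%N -> a i <= a i <= b i by [].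
  rewrite big_ord0 mulr1; apply.
  by apply: lee_nneseries => [k _ _|k _]; rewrite !big_ord0 !mulr1 lee_fin.
have max_ge0 (x : R) : 0 <= Num.max 0 x by rewrite le_max lexx.
pose vol k := \prod_(i < n) Num.max 0 (q k i - p k i).
have vol0 k : 0 <= vol k by apply: prodr_ge0 => i _; exact: max_ge0.
pose D : set R := [set` `[a n, b n]].
have mD : measurable D by exact: measurable_itv.
have slice (t : R) : D t -> ((C * \prod_(i < n) Num.max 0 (b i - a i))%:E <=
    \sum_(k <oo) ((w k * vol k)%:E * (\1_[set` `[p k n, q k n]] t)%:E))%E.
  rewrite /D/= in_itv/= => Dt.
  under eq_eseriesr do rewrite -EFinM mulrAC.
  apply: IH => // [k|v vab]; first by rewrite mulr_ge0// indicE.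
  pose v' i := if i == n then t else v i.
  have -> : (\sum_(k <oo) (w k * \1_[set` `[p k n, q k n]] t *
        \prod_(i < n) \1_[set` `[p k i, q k i]] (v i))%:E =
      \sum_(k <oo)
        (w k * \prod_(i < n.+1) \1_[set` `[p k i, q k i]] (v' i))%:E)%E.
    apply: eq_eseriesr => k _; congr EFin.
    rewrite big_ord_recr/= {2}/v' eqxx mulrAC mulrA; congr (_ * _ * _).
    by apply: eq_bigr => i _; rewrite /v' ltn_eqF.
  apply: cover => i; rewrite ltnS leq_eqVlt /v'.
  by case: eqP => [->//|_/=]; exact: vab.
have mi k : measurable_fun D (EFin \o (\1_[set` `[p k n, q k n]] : R -> R)).
  exact/measurable_EFinP/measurable_indic.
have mwi k : measurable_fun D
    (fun t : R => (w k * vol k)%:E * (\1_[set` `[p k n, q k n]] t)%:E)%E.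
  exact: measurable_funeM (mi k).
(* The last side length is the measure of [D], so the left side is the integral over [D] of a
   constant that [slice] bounds pointwise. *)
rewrite big_ord_recr/= mulrA EFinM -lebesgue_measure_segment -/D -integral_cst//.
apply: (@le_trans _ _ (\int[lebesgue_measure]_(t in D)
    \sum_(k <oo) ((w k * vol k)%:E * (\1_[set` `[p k n, q k n]] t)%:E))%E).
  apply: ge0_le_integral => //.
  - by move=> t _; rewrite lee_fin mulr_ge0// prodr_ge0.
  - apply: ge0_emeasurable_sum => [k t _ _|k _].
      by rewrite -EFinM lee_fin !mulr_ge0// indicE.
    exact: mwi.
have wi0 k t : (0 <= (w k * vol k)%:E * (\1_[set` `[p k n, q k n]] t)%:E)%E.
  by rewrite -EFinM lee_fin !mulr_ge0// indicE.
rewrite [leLHS](integral_nneseries lebesgue_measure mD mwi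
  (fun k t _ => wi0 k t)).
apply: lee_nneseries => [k _ _|k _].
  exact: integral_ge0.
have ind0 t : D t -> (0 <= (EFin \o (\1_[set` `[p k n, q k n]] : R -> R)) t)%E.
  by move=> _; rewrite lee_fin indicE.
rewrite [leLHS](ge0_integralZl_EFin lebesgue_measure mD ind0 (mi k)) ?mulr_ge0//.
rewrite [X in (_ * X <= _)%E]integral_indic// big_ord_recr/= mulrA [leRHS]EFinM.
rewrite lee_wpmul2l ?lee_fin ?mulr_ge0//.
rewrite -lebesgue_measure_segment le_measure// inE//; exact: measurableI.
Qed.

Section lebesgue_boxes.
Context {R : realType} {m : nat}.
Local Notation V := 'rV[R]_m.+1.
Implicit Types (p : V * V) (A : set V).

(** At each point of the box, some box of the cover contributes an indicator product equal to 1, so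
    the covering inequality holds with [C] and all weights equal to 1. *)
Lemma le_box_vol_lebesgue_outer p : ((box_vol p)%:E <= lebesgue_outer (box p))%E.
Proof.
apply: le_ereal_inf_tmp => _ [B pB <-].
(* Coordinates are indexed by [nat] to fit the induction on their number. *)
pose ext (v : V) (i : nat) : R := v ord0 (inord i).
have volE q : box_vol q = \prod_(i < m.+1) Num.max 0 (ext q.2 i - ext q.1 i).
  by apply: eq_bigr => i _; rewrite /ext inord_val.
rewrite volE -[X in X%:E]mul1r.
under eq_eseriesr do rewrite volE -[X in X%:E]mul1r.
apply: (@le_prod_nneseries_indic _ _ _ _ (fun k => ext (B k).1)
  (fun k => ext (B k).2) (fun=> 1)) => // v vp.
have [j _ Bj] : (\bigcup_k box (B k)) (\row_i v i).
  by apply: pB => i; have := vp i (ltn_ord i); rewrite mxE /ext inord_val.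
rewrite (@nneseriesD1 _ _ j)//; last first.
  by move=> k _; rewrite lee_fin mul1r; apply: prodr_ge0 => i _; rewrite indicE.
rewrite big1 ?mulr1 => [|i _].
  rewrite leeDl// nneseries_ge0// => k _ _.
  by rewrite lee_fin mul1r; apply: prodr_ge0 => i _; rewrite indicE.
by rewrite indicE mem_set//= in_itv/=; have := Bj i; rewrite mxE /ext inord_val.
Qed.

Lemma lebesgue_outer_box p : lebesgue_outer (box p) = (box_vol p)%:E.
Proof.
apply/le_anti; rewrite le_box_vol_lebesgue_outer andbT.
(* The box covers itself, padded with degenerate boxes of volume 0. *)
apply: ereal_inf_lbound; exists (fun k => if k == 0%N then p else (0, 0)).
  by move=> v pv; exists 0%N.
rewrite (@nneseriesD1 _ _ 0%N)//=; last by move=> k _; rewrite lee_fin box_vol_ge0.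
by rewrite eseries0 ?adde0// => k _; case: eqP => //= _ _; rewrite box_vol_diag.
Qed.

Lemma lebesgue_rV_interior_gt0 A (v : V) : A° v -> (0 < lebesgue_rV A)%E.
Proof.
move=> /nbhs_ballP[e /= e0 veA].
(* Half the radius keeps this closed box inside the open ball. *)
pose p : V * V := (v, \row_i (v ord0 i + e / 2)).
have e20 : 0 < e / 2 by rewrite divr_gt0.
apply: (@lt_le_trans _ _ (lebesgue_outer (box p))).
  rewrite lebesgue_outer_box lte_fin; apply: prodr_gt0 => i _.
  by rewrite /= mxE addrAC subrr add0r lt_max e20 orbT.
apply: le_lebesgue_outer => w pw; apply: veA; split => // i j.
rewrite [i]ord1 /ball/= distrC.
have := pw j; rewrite /= mxE -lerBlDl => /andP[vw wv].
rewrite ger0_norm ?subr_ge0//; apply: le_lt_trans wv _.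
by rewrite ltr_pdivrMr// mulr_natr mulr2n ltrDl.
Qed.

(** A null set has empty interior, and [A] is the closure of its interior. *)
Lemma regclosed_lebesgue0 A : regclosed A -> lebesgue_rV A = 0%E -> A = set0.
Proof.
move=> rA A0; rewrite -rA; suff -> : A° = set0 by rewrite closure0.
rewrite -subset0 => v /lebesgue_rV_interior_gt0.
by rewrite A0 ltxx.
Qed.

Lemma lebesgue_rV_fin_bigcup0 (I : finType) (B : I -> set V) :
  (forall i, lebesgue_rV (B i) = 0%E) -> lebesgue_rV (\bigcup_i B i) = 0%E.
Proof.
move=> B0; suff -> : \bigcup_i B i = \big[setU/set0]_(i in predT) B i.
  apply: (big_ind (fun X => lebesgue_rV X = 0%E)) => //.
  move=> X Y X0 Y0; apply/le_anti/andP; split; last exact: lebesgue_outer_ge0.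
  apply: (le_trans (outer_measureU2 lebesgue_outer_measure X Y)).
  by rewrite -[leLHS]/(lebesgue_rV X + lebesgue_rV Y)%E X0 Y0 adde0.
by rewrite -bigcup_pred; apply: eq_bigcupl; split.
Qed.

Definition unit_cube : set V := box (0, const_mx 1).

Lemma lebesgue_unit_cube : lebesgue_rV unit_cube = 1%E.
Proof.
rewrite [LHS]lebesgue_outer_box /box_vol big1// => i _.
by rewrite !mxE subr0 max_r.
Qed.
End lebesgue_boxes.

(** * The empty set and the unit cube *)

Section jordan_facts.
Context {R : realType} {m : nat}.
Local Notation V := 'rV[R]_m.+1.
Implicit Types (A : set V).

Lemma regular_jordan0 : regular_jordan (set0 : set V).
Proof.
have bd0 : bounded_set (set0 : set V) by rewrite /= /bounded_near; near=> M => v [].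
split; split => //; last by rewrite /regclosed interior0 closure0.
by rewrite closure0 set0D; exact: lebesgue_outer0.
Unshelve. all: by end_near. Qed.

(** The boundary lies in finitely many faces, each a box with a side of length 0. *)
Lemma jordan_unit_cube : jordan (unit_cube : set V).
Proof.
split.
  rewrite /= /bounded_near; near=> M => v v01 /=.
  rewrite [leLHS]/Num.norm/= mx_normrE.
  apply/bigmax_leP; split => // -[i j] _ /=; rewrite [i]ord1.
  have := v01 j; rewrite !mxE => /andP[v0 v1]; rewrite ger0_norm//.
  by apply: (le_trans v1); near: M; exact: nbhs_pinfty_ge.
pose face (i : 'I_m.+1) (t : R) : V * V :=
  (\row_j (if j == i then t else 0), \row_j (if j == i then t else 1)).
have face0 i t : lebesgue_rV (box (face i t)) = 0%E.
  rewrite [LHS]lebesgue_outer_box /box_vol (bigD1 i)//= !mxE eqxx subrr maxxx.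
  by rewrite mul0r.
apply/le_anti/andP; split; last exact: lebesgue_outer_ge0.
have <- : lebesgue_rV (\bigcup_i (box (face i 0) `|` box (face i 1))) = 0%E.
  apply: lebesgue_rV_fin_bigcup0 => i.
  apply/le_anti/andP; split; last exact: lebesgue_outer_ge0.
  by apply: (le_trans (outer_measureU2 lebesgue_outer_measure _ _));
    rewrite -[leLHS]/(lebesgue_rV _ + lebesgue_rV _)%E !face0 adde0.
apply: le_lebesgue_outer => v [cv nv].
have {cv} v01 : unit_cube v.
  move: cv; suff : closed (unit_cube : set V) by move/closure_id => <-.
  have -> : unit_cube = \bigcap_i ((fun v : V => v ord0 i) @^-1` [set` `[0, 1]]).
    apply/seteqP; split => w /= h i => [_|]; have := h i; rewrite /= in_itv/= !mxE //.
    exact.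
  apply: closed_bigI => i _; apply: closed_comp; last exact: itv_closed.
  by move=> w _; exact: coord_continuous.
(* Off the faces every coordinate of [v] lies strictly between 0 and 1, and these finitely many open
   conditions persist near [v]. *)
apply: contrapT => nface; apply: nv.
suff : \forall w \near v, forall i, 0 < (w : V) ord0 i < 1.
  by apply: filterS => w h i; rewrite !mxE; have /andP[/ltW-> /ltW->] := h i.
apply: (@filter_forall _ 'I_m.+1 (fun i (w : V) => 0 < w ord0 i < 1) _
  (nbhs_filter v)) => i.
have vi : [set` `]0, 1[] (v ord0 i).
  have := v01 i; rewrite !mxE /= in_itv/= => /andP[v0 v1].
  have facej t j : t = v ord0 i ->
      (face i t).1 ord0 j <= v ord0 j <= (face i t).2 ord0 j.
    move=> ->; rewrite /face/= !mxE; case: eqP => [->|_]; first by rewrite lexx.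
    by have := v01 j; rewrite !mxE.
  rewrite !lt_neqAle v0 v1 !andbT; apply/andP; split; apply/eqP => h;
    apply: nface; exists i => //; [left|right] => j; exact: facej.
have vc : (fun w : V => w ord0 i) @ v --> v ord0 i by exact: coord_continuous.
have nvi : nbhs (v ord0 i) [set` `]0, 1[] by apply: open_nbhs_nbhs; split.
apply: (@filterS _ _ (nbhs_filter v) _ _ _ (vc _ nvi)) => w /=.
by rewrite in_itv.
Unshelve. all: by end_near. Qed.

End jordan_facts.

(** * The cells of a partition average *)

Section partition_averages.
Context {R : realType} {m : nat}.
Local Notation V := 'rV[R]_m.+1.
Variables (n : nat) (A : 'I_n.+1 -> set V).
Implicit Types chi : {set 'I_n.+1}.

Lemma Omega_sub chi k : k \in chi -> Omega A chi `<=` A k.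
Proof.
move=> kchi; rewrite /Omega; case: eqP => [chi0|_]; first by rewrite chi0 inE in kchi.
by move=> v [Av _]; exact: Av.
Qed.

Lemma Omega_subC chi k : k \notin chi -> Omega A chi `<=` ~` A k.
Proof.
move=> kchi; rewrite /Omega; case: eqP => [_ //|_ v [_ nA] Akv].
by apply: nA; exists k => //; exact/negP.
Qed.

Lemma Omega_set0 chi i j :
  i \in chi -> j \notin chi -> A i `<=` A j -> Omega A chi = set0.
Proof.
move=> ichi jchi Aij; rewrite -subset0 => v Ov.
exact: (Omega_subC jchi Ov (Aij v (Omega_sub ichi Ov))).
Qed.

Lemma Omega_congr chi v w :
  (forall k, A k v <-> A k w) -> Omega A chi v -> Omega A chi w.
Proof.
rewrite /Omega; case: eqP => // _ vw [Av nAv]; split.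
  by move=> k /Av /vw.
by move=> [l lchi /vw Alv]; apply: nAv; exists l.
Qed.

(* Off the boundaries of the [A k], membership in each [A k] is locally
   constant. *)
Lemma boundary_Omega chi : closure (Omega A chi) `\` (Omega A chi)° `<=`
  \bigcup_k (closure (A k) `\` (A k)°).
Proof.
move=> v [cv nv]; apply: contrapT => nA.
have near_eq : \forall w \near v, forall k, A k w <-> A k v.
  apply: (@filter_forall _ 'I_n.+1 (fun k w => A k w <-> A k v) _
    (nbhs_filter v)) => k.
  have [|nAk] := pselect ((A k)° v).
    move=> Ak; have Akv := nbhs_singleton Ak.
    by apply: (@filterS _ _ (nbhs_filter v) _ _ _ Ak).
  have nAkv : (~` A k)° v.
    by rewrite interiorC => cAk; apply: nA; exists k.
  have nAv := nbhs_singleton nAkv.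
  by apply: (@filterS _ _ (nbhs_filter v) _ _ _ nAkv).
(* The neighbourhood meets the cell, and its points all lie in the same [A k], so it is contained in
   the cell and [v] is interior. *)
have [u [Ou uv]] := cv _ near_eq.
apply: nv; apply: (@filterS _ _ (nbhs_filter v) _ _ _ near_eq) => w wv.
apply: Omega_congr Ou => k.
by split => [/uv/wv|/wv/uv].
Qed.

Lemma jordan_Omega chi : (forall k, jordan (A k)) -> jordan (Omega A chi).
Proof.
move=> jA; split.
  (* A nonempty [chi] puts the cell inside a bounded [A k]; for empty [chi] boundedness rests on the
     convention that the cell is [set0]. *)
  have [->|[k kchi]] := set_0Vmem chi.
    by rewrite /Omega eqxx; have [[]] := @regular_jordan0 R m.
  have [bA _] := jA k; move: bA; rewrite /= /bounded_near.
  by apply: filterS => M AM v /(Omega_sub kchi)/AM.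
apply/le_anti/andP; split; last exact: lebesgue_outer_ge0.
rewrite -(lebesgue_rV_fin_bigcup0 (fun k => (jA k).2)).
exact/le_lebesgue_outer/boundary_Omega.
Qed.

End partition_averages.

(** The value is regular closed and has measure [t * 0]. *)
Lemma subset_generating_set0 (R : realType) (m : nat)
    (Psi : set 'rV[R]_m.+1 -> R -> set 'rV[R]_m.+1) (t : R) :
  subset_generating Psi -> t \in `[0, 1] -> Psi set0 t = set0.
Proof.
move=> hPsi t01; have j0 := (@regular_jordan0 R m).1.
apply: regclosed_lebesgue0; first exact: (subset_generating_regular hPsi j0 t01).2.2.
by rewrite (subset_generating_measure hPsi j0 t01) [X in (_ * X)%E]lebesgue_outer0 mule0.
Qed.

(** * Sums of weights over upsets, and the real operator *)

Definition upset (n : nat) (chi : {set 'I_n}) :=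
  forall i j : 'I_n, (i <= j)%N -> i \in chi -> j \in chi.

Section sums.
Context {R : realType}.

Lemma sum_set_itv01 (n : nat) (c : 'I_n -> R) (chi : {set 'I_n}) :
  (forall i, 0 <= c i) -> \sum_i c i = 1 -> \sum_(i in chi) c i \in `[0, 1].
Proof.
move=> c0 c1; rewrite in_itv/= sumr_ge0//= -c1 [leRHS](bigID (mem chi))/=.
by rewrite lerDl sumr_ge0.
Qed.

(* Abel summation, one step at a time. *)
Lemma tail_sums_ge0 (n : nat) (d g : 'I_n -> R) :
  (forall j : nat, 0 <= \sum_(i < n | (j <= i)%N) d i) ->
  (forall i, 0 <= g i) -> {homo g : i j / (i <= j)%N >-> i <= j} ->
  0 <= \sum_i d i * g i.
Proof.
elim: n => [|n IH] in d g *; first by rewrite big_ord0.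
(* Subtracting the least value [g ord0] leaves a nonnegative nondecreasing [h]; the factor of
   [g ord0] is the full sum of [d], which is the tail sum from 0. *)
move=> d0 g0 gincr; pose h (i : 'I_n) := g (lift ord0 i) - g ord0.
have -> : \sum_i d i * g i =
    (\sum_i d i) * g ord0 + \sum_i d (lift ord0 i) * h i.
  rewrite !big_ord_recl mulrDl -addrA; congr (_ + _).
  rewrite mulr_suml -big_split; apply: eq_bigr => i _ /=.
  by rewrite -mulrDr /h addrC subrK.
rewrite addr_ge0 ?mulr_ge0//; first exact: d0 0%N.
apply: IH => [j|i|i j ij]; last 2 first.
- by rewrite subr_ge0 gincr.
- by rewrite lerD2r gincr.
have := d0 j.+1; rewrite big_mkcond big_ord_recl/= add0r.
by rewrite [in X in _ -> X]big_mkcond.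
Qed.

End sums.

Section monotone_sums.
Context {R : realType} {l : nat}.
Variables (x : 'I_l.+1 -> R) (c : 'I_l.+1 -> R -> R).
Hypothesis x_incr : {homo x : i j / (i < j)%N >-> i < j}.

Lemma node_mono : {mono x : i j / (i <= j)%N >-> i <= j}.
Proof.
move=> i j; case: (leqP i j) => [|ji]; last by apply/negbTE; rewrite -ltNge x_incr.
by rewrite leq_eqVlt => /predU1P[/val_inj->|/x_incr/ltW//]; rewrite lexx.
Qed.

(* Extends the indicator of an upset of nodes to a monotone predicate. *)
Definition above (chi : {set 'I_l.+1}) (t : R) : bool :=
  [exists k in chi, x k <= t].

Lemma above_homo chi s t : s <= t -> above chi s -> above chi t.
Proof.
by move=> st /exists_inP[k kchi xs]; apply/exists_inP; exists k => //; exact: le_trans st.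
Qed.

Lemma above_node chi i : upset chi -> above chi (x i) = (i \in chi).
Proof.
move=> uchi; apply/exists_inP/idP => [[k kchi]|ichi]; last by exists i.
by rewrite node_mono => /uchi; apply.
Qed.

Definition upset_sums_nondecreasing := forall chi : {set 'I_l.+1}, upset chi ->
  {in `[0, 1] &, {homo (fun y => \sum_(k in chi) c k y) : y z / y <= z}}.

Lemma real_operatorN (f : R -> R) y :
  real_operator x c (fun t => - f t) y = - real_operator x c f y.
Proof. by rewrite /real_operator -sumrN; apply: eq_bigr => i _; rewrite mulrN. Qed.

Lemma real_monotonicity_upset_sums :
  monotonicity_preserving (real_operator x c) -> upset_sums_nondecreasing.
Proof.
move=> mono chi uchi y z y01 z01 yz.
have [+ _] := mono (fun t => (above chi t)%:R).
have opE t : real_operator x c (fun t => (above chi t)%:R) t = \sum_(k in chi) c k t.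
  rewrite /real_operator [RHS]big_mkcond; apply: eq_bigr => i _ /=.
  by rewrite above_node//; case: ifP => _; rewrite ?mulr1 ?mulr0.
rewrite -!opE; apply => // s t _ _ st.
by rewrite ler_nat; case: (boolP (above chi s)) => // /(above_homo st) ->.
Qed.

Hypotheses (x_ge0 : forall i, 0 <= x i) (x_le1 : forall i, x i <= 1).
Hypothesis c_sum1 : {in `[0, 1], forall y, \sum_i c i y = 1}.

Lemma upset_sums_real_monotonicity :
  upset_sums_nondecreasing -> monotonicity_preserving (real_operator x c).
Proof.
move=> upc.
have x01 i : x i \in `[0, 1] by rewrite in_itv/= x_ge0 x_le1.
have incr f : {in `[0, 1] &, {homo f : s t / s <= t}} ->
    {in `[0, 1] &, {homo real_operator x c f : s t / s <= t}}.
  move=> fincr y z y01 z01 yz.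
  (* Both weight families sum to 1, so [d] sums to 0 and shifting [f] by its value at the first node
     changes nothing; the shift makes [g] nonnegative, as Abel summation requires. *)
  pose d i := c i z - c i y; pose g i := f (x i) - f (x ord0).
  have -> : real_operator x c f z = real_operator x c f y + \sum_i d i * g i.
    have d0 : \sum_i d i = 0 by rewrite sumrB !c_sum1// subrr.
    have -> : \sum_i d i * g i = \sum_i d i * f (x i) - (\sum_i d i) * f (x ord0).
      by rewrite mulr_suml -sumrB; apply: eq_bigr => i _; rewrite mulrBr.
    rewrite d0 mul0r subr0.
    by rewrite -big_split; apply: eq_bigr => i _ /=; rewrite -mulrDl addrC subrK.
  rewrite lerDl; apply: tail_sums_ge0 => [j|i|i j ij].
  - have := upc (finset (fun i : 'I_l.+1 => (j <= i)%N)) _ y z y01 z01 yz.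
    rewrite -subr_ge0 -sumrB; under eq_bigl do rewrite inE; apply.
    by move=> i k ik; rewrite !inE => /leq_trans; apply.
  - by rewrite subr_ge0 fincr// node_mono.
  - by rewrite lerD2r fincr// node_mono.
move=> f; split => [|fdecr]; first exact: incr.
move=> y z y01 z01 yz; rewrite -lerN2 -!real_operatorN.
by apply: incr => // s t s01 t01 st; rewrite lerN2 fdecr.
Qed.

End monotone_sums.

(** * Monotonicity of the set operator *)

Section set_operators.
Context {R : realType} {m : nat}.
Variable Psi : set 'rV[R]_m.+1 -> R -> set 'rV[R]_m.+1.
Hypothesis hPsi : subset_generating Psi.
Context {l : nat}.
Variables (x : 'I_l.+1 -> R) (c : 'I_l.+1 -> R -> R).
Hypothesis x_incr : {homo x : i j / (i < j)%N >-> i < j}.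
Hypotheses (x_ge0 : forall i, 0 <= x i) (x_le1 : forall i, x i <= 1).
Hypothesis c_ge0 : forall i, {in `[0, 1], forall y, 0 <= c i y}.
Hypothesis c_sum1 : {in `[0, 1], forall y, \sum_i c i y = 1}.

Let sum01 (chi : {set 'I_l.+1}) y : y \in `[0, 1] -> \sum_(k in chi) c k y \in `[0, 1].
Proof.
by move=> y01; apply: sum_set_itv01 (c_sum1 y01) => i; exact: c_ge0.
Qed.

(** The cells do not depend on the evaluation point, so the two unions are compared cell by cell
    through the monotonicity of [Psi]; empty cells contribute [set0]. *)
Lemma set_operator_sub (F : R -> set 'rV[R]_m.+1) y z :
  (forall i, jordan (F (x i))) -> y \in `[0, 1] -> z \in `[0, 1] ->
  (forall chi, Omega (fun i => F (x i)) chi !=set0 ->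
    \sum_(k in chi) c k y <= \sum_(k in chi) c k z) ->
  set_operator Psi x c F y `<=` set_operator Psi x c F z.
Proof.
move=> jF y01 z01 yz v [chi _ Pv]; exists chi => //.
have [Om0|Ochi] := eqVneq (Omega (fun i => F (x i)) chi) set0.
  by move: Pv; rewrite /= Om0 subset_generating_set0// sum01.
apply: (subset_generating_homo hPsi _ _ _ _ Pv); rewrite ?sum01//.
  exact: jordan_Omega.
by apply: yz; exact/set0P.
Qed.

Lemma upset_sums_set_monotonicity :
  upset_sums_nondecreasing c -> set_monotonicity_preserving (set_operator Psi x c).
Proof.
move=> upc F rF.
have x01 i : x i \in `[0, 1] by rewrite in_itv/= x_ge0 x_le1.
have jF i : jordan (F (x i)) by exact: (rF _ (x01 i)).1.
split => Fmono y z y01 z01 yz; apply: set_operator_sub => // chi [v Ov].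
  apply: upc => // i j ij ichi; apply: contrapT => /negP jchi.
  suff Om0 : Omega (fun i => F (x i)) chi = set0 by rewrite Om0 in Ov.
  by apply: Omega_set0 ichi jchi _; apply: Fmono; rewrite ?node_mono.
(* For nonincreasing [F] it is the complement of [chi] that is an upset; passing to complementary
   sums reverses the inequality. *)
have /(_ (~: chi)%SET _ y z y01 z01 yz) := upc.
have compl t : t \in `[0, 1] ->
    \sum_(k in (~: chi)%SET) c k t = 1 - \sum_(k in chi) c k t.
  move=> t01; rewrite -(c_sum1 t01) [X in _ = X - _](bigID (mem chi))/= addrAC subrr add0r.
  by apply: eq_bigl => k; rewrite inE.
rewrite !compl// lerD2l lerN2; apply => i j ij; rewrite !inE => ichi.
apply/negP => jchi.
suff Om0 : Omega (fun i => F (x i)) chi = set0 by rewrite Om0 in Ov.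
by apply: Omega_set0 jchi ichi _; apply: Fmono; rewrite ?node_mono.
Qed.

(** A point of [A] lies in [F (x k)] exactly for [k] in [chi], and any other point in none, so [chi]
    is the only index whose cell can be nonempty. *)
Lemma set_operator_above (A : set 'rV[R]_m.+1) (chi : {set 'I_l.+1}) y :
  upset chi -> chi != finset.set0 -> y \in `[0, 1] ->
  set_operator Psi x c (fun t => if above x chi t then A else set0) y =
  Psi A (\sum_(k in chi) c k y).
Proof.
move=> uchi chi0 y01; set F := fun t => _.
have FE i : F (x i) = if i \in chi then A else set0.
  by rewrite /F above_node.
have OE : Omega (fun i => F (x i)) chi = A.
  apply/seteqP; split=> v.
    have /set0Pn[k kchi] := chi0.
    by move=> /(Omega_sub kchi); rewrite FE kchi.
  rewrite /Omega (negbTE chi0) => Av; split => [k kchi|[k /= /negP kchi]].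
    by rewrite FE; rewrite /= in kchi; rewrite kchi.
  by rewrite FE (negbTE kchi).
rewrite /set_operator /partition_average (bigcupID [set chi]) setTI bigcup_set1 OE.
rewrite setTI bigcup0 ?setU0// => psi /eqP psichi.
suff -> : Omega (fun i => F (x i)) psi = set0 by rewrite subset_generating_set0// sum01.
have [i ichi] : exists i, (i \in chi) != (i \in psi).
  apply/existsP; apply: contrapT => /negP; rewrite negb_exists => /forallP h.
  by case/eqP: psichi; apply/setP => i; have := h i; rewrite negbK => /eqP.
case: (boolP (i \in psi)) ichi => ipsi; case: (boolP (i \in chi)) => // ichi _.
  by rewrite -subset0 => v /(Omega_sub ipsi); rewrite FE (negbTE ichi).
(* Here [psi] misses some [i] of [chi], so the point avoids [A]; but [psi] is nonempty, and any [k]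
   in it puts the point in [A] or in [set0]. *)
rewrite -subset0 => v Ov; have := Omega_subC ipsi Ov; rewrite FE ichi; apply.
move: Ov; rewrite /Omega; case: eqP => // /eqP/set0Pn[k kpsi] [/(_ k kpsi) + _].
by rewrite FE; case: ifP.
Qed.

Lemma set_monotonicity_upset_sums :
  set_monotonicity_preserving (set_operator Psi x c) -> upset_sums_nondecreasing c.
Proof.
move=> mono chi uchi y z y01 z01 yz.
have [->|chi0] := eqVneq chi finset.set0; first by rewrite !big_set0.
have one01 : (1 : R) \in `[0, 1] by rewrite in_itv/= lexx ler01.
(* The test function needs regular values: [Psi] at 1 turns the Jordan unit cube into a regular
   Jordan set of the same measure. *)
pose A := Psi unit_cube 1.
have rA : regular_jordan A by exact: subset_generating_regular jordan_unit_cube one01.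
have A1 : lebesgue_rV A = 1%E.
  rewrite (subset_generating_measure hPsi jordan_unit_cube one01).
  by rewrite lebesgue_unit_cube mule1.
have measPsi t : t \in `[0, 1] -> lebesgue_rV (Psi A t) = t%:E.
  by move=> t01; rewrite (subset_generating_measure hPsi rA.1 t01) A1 mule1.
have rF : {in `[0, 1], forall t, regular_jordan (if above x chi t then A else set0)}.
  by move=> t _; case: ifP => _ //; exact: regular_jordan0.
have homoF : {in `[0, 1] &,
    {homo (fun t => if above x chi t then A else set0) : s t / s <= t >-> s `<=` t}}.
  by move=> s t _ _ st; case: ifP => [xs|_ v//]; rewrite (above_homo st xs).
(* Inclusion of the averages gives an inequality of measures, which are the two sums because [A] has
   measure 1. *)
have := (mono _ rF).1 homoF y z y01 z01 yz => /le_lebesgue_outer.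
rewrite !set_operator_above// -[X in (X <= _)%E]/(lebesgue_rV _).
by rewrite -[X in (_ <= X)%E]/(lebesgue_rV _) !measPsi ?sum01// lee_fin.
Qed.

End set_operators.

Theorem corollary7p5 (R : realType) (m : nat)
    (Psi : set 'rV[R]_m.+1 -> R -> set 'rV[R]_m.+1)
    (hPsi : subset_generating Psi)
    (l : nat) (x : 'I_l.+1 -> R)
    (x_first : x ord0 = 0) (x_last : x ord_max = 1)
    (x_incr : {homo x : i j / (i < j)%N >-> i < j})
    (c : 'I_l.+1 -> R -> R)
    (c_ge0 : forall i, {in `[0, 1], forall y, 0 <= c i y})
    (c_sum1 : {in `[0, 1], forall y, \sum_(i < l.+1) c i y = 1}) :
  set_monotonicity_preserving (set_operator Psi x c) <->
  monotonicity_preserving (real_operator x c).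
Proof.
have x_ge0 i : 0 <= x i by rewrite -x_first node_mono.
have x_le1 i : x i <= 1 by rewrite -x_last node_mono// -ltnS.
split.
  move=> /(set_monotonicity_upset_sums hPsi x_incr c_ge0 c_sum1).
  exact: upset_sums_real_monotonicity.
move=> /(real_monotonicity_upset_sums x_incr).
exact: upset_sums_set_monotonicity.
Qed.
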